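(* Let $D=(C_{\rm comp}\otimes C_0)^\perp$, let $\underline D\subseteq\mathbb F^{Nn_0}$ be the puncturing of $D$ at the coordinate set $I_0$, and let $(\beta_j)_{j\in J}$ be any family of nonzero elements of $\mathbb F$. Define $$\underline{\Lambda}_\beta=\bigl\{(\lambda_j)_{j\in J}\in\mathbb B^{Nn_0} : (\lambda_j\beta_j)_{j\in J}\in\underline D\bigr\}.$$ Then $$\dim_{\mathbb B}(\underline{\Lambda}_\beta)\ \ge\ Nn_0-mK(k_0-1).$$ In particular, if $k_0\le \dfrac{Nn_0}{Km}$, then $\dim_{\mathbb B}(\underline{\Lambda}_\beta)\ge Km$.
   Context: $\mathbb B=\mathbb F_q$ is a finite field and $\mathbb F$ is an extension field of $\mathbb B$ of degree $m$. An $[\ell,k]_{\mathbb F}$ code is a $k$-dimensional $\mathbb F$-linear subspace of $\mathbb F^{\ell}$; duals are with respect to the standard bilinear form. Base code: $C_0$ is an $[n_0+1,k_0]_{\mathbb F}$ code, with coordinates indexed by $0,\dots,n_0$, admitting a generator matrix (with $k_0$ linearly independent rows) of the form $G_0=\begin{bmatrix}-1&\phi\\0&\overline{G_0}\end{bmatrix}$, where $\phi\in\mathbb F^{n_0}$ is nonzero and $\overline{G_0}\in\mathbb F^{(k_0-1)\times n_0}$. Computation code: let $1\le K<N$ and let $H_{\rm comp}\in\mathbb F^{(N-K)\times N}$ be a matrix whose $i$-th row ($1\le i\le N-K$) is $(g_{i,1},\dots,g_{i,K+i-1},-1,0,\dots,0)$, with $-1$ in column $K+i$ and arbitrary $g_{i,l}\in\mathbb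 F$. Then $C_{\rm comp}=\{c\in\mathbb F^N: H_{\rm comp}c^T=0\}$ is an $[N,K]_{\mathbb F}$ code with a systematic generator matrix $G_{\rm comp}$, whose first $K$ columns form the identity matrix. $C_{\rm comp}\otimes C_0$ is the $[N(n_0+1),Kk_0]_{\mathbb F}$ code generated by the Kronecker product $G_{\rm comp}\otimes G_0$. Coordinates of $\mathbb F^{N(n_0+1)}$ are indexed by $0,\dots,N(n_0+1)-1$; $I_0=\{0,n_0+1,2(n_0+1),\dots,(N-1)(n_0+1)\}$ is the set of first positions of the $N$ blocks of length $n_0+1$, and $J=\{0,\dots,N(n_0+1)-1\}\setminus I_0$. Puncturing a code at $I_0$ means deleting the coordinates indexed by $I_0$ from all codewords. *)

(* Defs.v *)
From HB Require Import structures.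
From mathcomp Require Import all_boot all_order all_algebra all_field.
From mathcomp Require Export mxtens.

Set Implicit Arguments.
Unset Strict Implicit.
Unset Printing Implicit Defensive.

Import GRing.Theory.
Local Open Scope ring_scope.

(* Codewords are row vectors and linear codes are subspaces of 'rV[F]_l. *)

Section Codes.
Variable F : fieldType.

Definition mxrows k l (G : 'M[F]_(k, l)) : seq 'rV[F]_l :=
  [seq row i G | i : 'I_k].

Definition row_code k l (G : 'M[F]_(k, l)) : {vspace 'rV[F]_l} :=
  <<mxrows G>>%VS.

(* The rows of G are linearly independent and span C. *)
Definition is_generator_mx k l (G : 'M[F]_(k, l)) (C : {vspace 'rV[F]_l}) :
  bool := basis_of C (mxrows G).

(* mulmxr H^T sends c to c *m H^T, the transpose of H *m c^T. *)
Definition parity_code r l (H : 'M[F]_(r, l)) : {vspace 'rV[F]_l} :=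
  lker (linfun (mulmxr H^T : 'rV[F]_l -> 'rV[F]_r)).

Lemma parity_codeP r l (H : 'M[F]_(r, l)) (c : 'rV[F]_l) :
  reflect (H *m c^T = 0) (c \in parity_code H).
Proof.
rewrite memv_ker lfunE /=; apply: (iffP eqP) => h.
  by apply: trmx_inj; rewrite trmx_mul trmxK h trmx0.
by apply: trmx_inj; rewrite trmx_mul trmxK h trmx0.
Qed.

(* It suffices to test orthogonality against a basis of C; see dual_codeP. *)
Definition dual_code l (C : {vspace 'rV[F]_l}) : {vspace 'rV[F]_l} :=
  (\bigcap_(i < \dim C)
     lker (linfun (mulmxr ((vbasis C)`_i)^T : 'rV[F]_l -> 'rV[F]_1)))%VS.

Lemma dual_codeP l (C : {vspace 'rV[F]_l}) (v : 'rV[F]_l) :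
  reflect (forall c, c \in C -> \sum_(j < l) v 0 j * c 0 j = 0)
          (v \in dual_code C).
Proof.
have dotE (c : 'rV[F]_l) : v *m c^T = (\sum_(j < l) v 0 j * c 0 j)%:M.
  apply/matrixP=> i j; rewrite !ord1 !mxE /=.
  by rewrite mulr1n; apply: eq_bigr => k _; rewrite !mxE.
have dot0 (c : 'rV[F]_l) :
    \sum_(j < l) v 0 j * c 0 j = 0 <-> v *m c^T = 0.
  rewrite dotE; split=> [->|/matrixP/(_ 0 0)]; first by rewrite raddf0.
  by rewrite !mxE mulr1n.
rewrite memvE; apply: (iffP subv_bigcapP) => [h c cC | h i _].
  apply/dot0; rewrite (coord_vbasis cC) linear_sum mulmx_sumr big1 // => i _.
  move: (h i isT); rewrite -memvE memv_ker lfunE /= => /eqP hi.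
  by rewrite linearZ /= -scalemxAr hi scaler0.
rewrite -memvE memv_ker lfunE /=; apply/eqP/dot0/h.
by apply: vbasis_mem; rewrite mem_nth // size_tuple.
Qed.

(* The coordinates outside I, kept in increasing order, are numbered by
   'I_#|~: I| through enum_val. *)
Definition delete_coords l (I : {set 'I_l}) (c : 'rV[F]_l) : 'rV[F]_#|~: I| :=
  \row_(j < #|~: I|) c 0 (enum_val j).

Fact delete_coords_is_linear l (I : {set 'I_l}) : linear (delete_coords I).
Proof. by move=> a u v; apply/rowP=> j; rewrite !mxE. Qed.

HB.instance Definition _ l (I : {set 'I_l}) :=
  GRing.isLinear.Build F 'rV[F]_l 'rV[F]_#|~: I| *:%R (delete_coords I)
    (@delete_coords_is_linear l I).

Definition puncture l (I : {set 'I_l}) (C : {vspace 'rV[F]_l}) :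
  {vspace 'rV[F]_#|~: I|} := (linfun (delete_coords I) @: C)%VS.

Lemma punctureP l (I : {set 'I_l}) (C : {vspace 'rV[F]_l}) d :
  reflect (exists2 c, c \in C & d = delete_coords I c) (d \in puncture I C).
Proof.
by apply: (iffP memv_imgP) => -[c cC ->]; exists c; rewrite // lfunE.
Qed.

(* Counting columns from 0, row i has its entry -1 in column K + i. *)
Definition is_comp_parity_mx K N (H : 'M[F]_(N - K, N)) : Prop :=
  forall (i : 'I_(N - K)) (j : 'I_N),
    (nat_of_ord j = (K + i)%N -> H i j = -1) /\ ((K + i < j)%N -> H i j = 0).

Definition is_systematic K N (G : 'M[F]_(K, N)) : Prop :=
  forall (i : 'I_K) (j : 'I_N),
    (j < K)%N -> G i j = (nat_of_ord i == nat_of_ord j)%:R.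

(* A computation code does have a systematic generator matrix. *)
Lemma systematic_exists K N (H : 'M[F]_(N - K, N)) : (K < N)%N ->
  is_comp_parity_mx H ->
  exists2 G : 'M[F]_(K, N),
    is_generator_mx G (parity_code H) & is_systematic G.
Proof.
move=> /ltnW /subnKC; rewrite /is_comp_parity_mx.
move: (N - K)%N H => r H eN; case: N / eN H => H hH.
set A := lsubmx H; set T := rsubmx H.
have Tunit : T \in unitmx.
  rewrite unitmxE det_trig; last first.
    apply/is_trig_mxP => i j ltij; rewrite mxE.
    by case: (hH i (rshift K j)) => _; apply; rewrite /= ltn_add2l.
  rewrite (eq_bigr (fun _ => -1)) => [|i _]; last first.
    by rewrite mxE; case: (hH i (rshift K i)) => h _; apply: h.
  by rewrite prodr_const unitrX // unitrN1.
pose G := row_mx 1%:M (- (invmx T *m A)^T) : 'M[F]_(K, K + r).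
have combE (k : 'I_#|'I_K| -> F) :
    \sum_(i < #|'I_K|) k i *: (mxrows G)`_i =
    (\row_j k (enum_rank j)) *m G.
  rewrite mulmx_sum_row (reindex _ (onW_bij _ (@enum_rank_bij 'I_K))) /=.
  apply: eq_bigr => i _; rewrite mxE; congr (_ *: _).
  rewrite /mxrows (nth_map i) ?enum_rankK ?nth_enum_rank //.
  by rewrite -cardE.
exists G; last first.
  move=> i j ltj; have -> : j = lshift r (Ordinal ltj) by apply: val_inj.
  by rewrite row_mxEl mxE.
have GH (x : 'rV[F]_K) : x *m G \in parity_code H.
  apply/parity_codeP; rewrite -[H]hsubmxK trmx_mul mulmxA tr_row_mx.
  rewrite mul_row_col trmx1 mulmx1 linearN /= trmxK mulmxN mulmxA.
  by rewrite mulmxV // mul1mx subrr mul0mx.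
have szG : size (mxrows G) == #|'I_K| by rewrite size_map -cardE.
apply/andP; split; last first.
  apply/(@freeP _ _ _ (Tuple szG)) => k; rewrite combE => /(congr1 lsubmx).
  rewrite mul_mx_row mulmx1 row_mxKl linear0 => /rowP h i.
  by move: (h (enum_val i)); rewrite !mxE enum_valK.
apply/eqP/vspaceP => c; apply/idP/idP => [h | /parity_codeP h].
  by rewrite (@coord_span _ _ _ (Tuple szG) _ h) combE GH.
have -> : c = lsubmx c *m G.
  rewrite -[LHS]hsubmxK mul_mx_row mulmx1; congr row_mx.
  move: h; rewrite -[H]hsubmxK -{1}[c]hsubmxK tr_row_mx mul_row_col.
  move=> /eqP; rewrite addrC addr_eq0 => /eqP h; apply: trmx_inj.
  rewrite mulmxN linearN /= trmx_mul trmxK -mulmxA -mulmxN -h.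
  by rewrite mulmxA mulVmx // mul1mx.
rewrite mulmx_sum_row; apply: memv_suml => i _; apply: memvZ.
by apply: memv_span; apply: map_f; rewrite mem_enum.
Qed.

Definition base_gen_mx k0 n0 (phi : 'rV[F]_n0) (G0bar : 'M[F]_(k0.-1, n0)) :
  'M[F]_(1 + k0.-1, 1 + n0) := block_mx (-1)%:M phi 0 G0bar.

(* [tensmx A B] is the Kronecker product whose (i, j) block is A i j *: B. *)
Definition tensor_code k1 l1 k2 l2 (G1 : 'M[F]_(k1, l1)) (G2 : 'M[F]_(k2, l2)) :
  {vspace 'rV[F]_(l1 * l2)} := row_code (tensmx G1 G2).

End Codes.

Definition block_heads N n0 : {set 'I_(N * (1 + n0))} :=
  [set p : 'I_(N * (1 + n0)) | (n0.+1 %| p)%N].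

Lemma card_block_headsC N n0 : #|~: block_heads N n0| = (N * n0)%N.
Proof.
pose f (p : 'I_N * 'I_n0) := mxtens_index (p.1, rshift 1 p.2).
have f_inj : injective f.
  by move=> [a b] [c d] /(can_inj (@mxtens_indexK _ _)) [-> /ord_inj ->].
have <- : #|[set: 'I_N * 'I_n0]| = (N * n0)%N.
  by rewrite cardsT card_prod !card_ord.
rewrite -(card_imset _ f_inj); apply: eq_card => p.
case: (mxtens_indexP p) => a b.
rewrite !inE /= -add1n dvdn_addr ?dvdn_mull //.
apply/idP/imsetP => [|[[c d] _ /(can_inj (@mxtens_indexK _ _)) [_ ->]]].
  case: (split_ordP b) => [d -> | d -> _]; first by rewrite ord1 dvdn0.
  by exists (a, d); rewrite ?inE.
by rewrite /= gtnNdvd //= add1n ltnS.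
Qed.

Section Lambda.
Variables (B : finFieldType) (F : fieldExtType B) (n : nat).
Variables (beta : 'rV[F]_n) (D : {vspace 'rV[F]_n}).

Definition Lambda_set : {set 'rV[B]_n} :=
  [set lam : 'rV[B]_n | \row_(j < n) (lam 0 j *: beta 0 j) \in D].

(* Lambda_set is closed under B-linear combinations, so this span has exactly
   the same elements; see mem_Lambda. *)
Definition Lambda : {vspace 'rV[B]_n} := <<enum Lambda_set>>%VS.

Lemma mem_Lambda (lam : 'rV[B]_n) :
  (lam \in Lambda) = (\row_(j < n) (lam 0 j *: beta 0 j) \in D).
Proof.
have E (x : 'rV[B]_n) : (x \in enum Lambda_set) =
  (\row_(j < n) (x 0 j *: beta 0 j) \in D) by rewrite mem_enum inE.
apply/idP/idP => [h|]; last by rewrite -E; exact: memv_span.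
pose X := in_tuple (enum Lambda_set).
have -> : \row_(j < n) (lam 0 j *: beta 0 j) =
  \sum_(i < size (enum Lambda_set))
    (coord X i lam)%:A *: \row_(j < n) (X`_i 0 j *: beta 0 j).
  apply/rowP=> j; rewrite mxE {1}(@coord_span _ _ _ X _ h) !summxE scaler_suml.
  apply: eq_bigr => i _; rewrite !mxE -scalerA.
  by rewrite -scalerAl mul1r.
by apply: memv_suml => i _; apply: memvZ; rewrite -E mem_nth.
Qed.

End Lambda.

(* Main.v *)
(* A word d on the non-head coordinates extends to the dual of Ccomp (x) C0 as
   soon as it is orthogonal to the rows of Gcomp (x) G0bar: put <phi, d_a> at the
   head of block a, which makes d orthogonal to the rows coming from (-1, phi).
   Hence membership in the punctured dual is implied by K (k0 - 1) equations over
   F, that is, m K (k0 - 1) equations over B. *)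
From HB Require Import structures.
Require Import Defs.
From mathcomp Require Import all_boot all_order all_algebra all_field.
From mathcomp Require Import zify.
Import Order.TTheory GRing.Theory Num.Theory.
Local Open Scope ring_scope.

Section CodeLemmas.
Variable F : fieldType.

Lemma mem_dual_row_code k l (G : 'M[F]_(k, l)) (v : 'rV[F]_l) :
  v *m G^T = 0 -> v \in dual_code (row_code G).
Proof.
move=> vG0; have dotE (w : 'rV[F]_l) :
    (v *m w^T) 0 0 = \sum_(j < l) v 0 j * w 0 j.
  by rewrite mxE; apply: eq_bigr => j _; rewrite mxE.
apply/dual_codeP => c; rewrite -dotE.
(* The words orthogonal to the fixed [v] form a subspace, so testing the rows of [G] suffices. *)
suff /subvP sub : (row_code G <= lker (linfun (mulmxr v^T)))%VS.
  move=> /sub; rewrite memv_ker lfunE /= => /eqP cv0.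
  by rewrite -[v *m _]trmxK trmx_mul trmxK cv0 trmx0 mxE.
apply/span_subvP => w /mapP[i _ ->]; rewrite memv_ker lfunE /= -row_mul.
by rewrite -[G *m _]trmxK trmx_mul trmxK vG0 trmx0 row0.
Qed.

(** The zero column in front of [G0bar] gives the checks the block layout of the codewords, so the
    non-head columns can be selected with the same [enum_val] that indexes the punctured word. *)
Lemma parity_sub_puncture_dual K N n0 k (Gcomp : 'M[F]_(K, N))
    (phi : 'rV[F]_n0) (G0bar : 'M[F]_(k.-1, n0)) :
  (parity_code
     (colsub enum_val (tensmx Gcomp (row_mx (0 : 'M_(_, 1)) G0bar)) :
        'M_(_, #|~: block_heads N n0|)) <=
   puncture (block_heads N n0)
     (dual_code (tensor_code Gcomp (base_gen_mx phi G0bar))))%VS.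
Proof.
set A := tensmx _ _; set I := block_heads N n0.
apply/subvP => d /parity_codeP Ad0; apply/punctureP.
(* [x] is [d] extended by zero at the block heads. *)
pose x : 'rV_(N * (1 + n0)) := d *m rowsub enum_val 1%:M.
have x_head p : p \in I -> x 0 p = 0.
  move=> pI; rewrite mxE big1 // => j _; rewrite !mxE.
  case: eqP => [pE|]; last by rewrite mulr0.
  by have := enum_valP j; rewrite inE pE pI.
have x_del : delete_coords I x = d.
  apply/rowP => j; rewrite !mxE (bigD1 j) //= big1 => [|i nij].
    by rewrite !mxE eqxx mulr1 addr0.
  by rewrite !mxE (inj_eq enum_val_inj) (negPf nij) mulr0.
have xA0 : x *m A^T = 0.
  rewrite -mulmxA -rowsubE; apply: trmx_inj.
  rewrite trmx_mul trmx0 -Ad0; congr (_ *m _).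
  by apply/matrixP => i j; rewrite !mxE.
have head_in (a : 'I_N) (t : 'I_1) : mxtens_index (a, lshift n0 t) \in I.
  by rewrite inE ord1 /= addn0 dvdn_mull.
have nhead (p : 'I_(N * (1 + n0))) : p \notin I ->
    exists a s, p = mxtens_index (a, rshift 1 s).
  case: (mxtens_indexP p) => a t; case: (split_ordP t) => [u -> | u -> _].
    by rewrite head_in.
  by exists a, u.
(* Right multiplication by [P] sends a block (h, y) to (<phi, y>, 0), so [tensmx 1%:M P] computes
   all the head values at once. *)
pose P : 'M[F]_(1 + n0) := block_mx 0 0 phi^T 0.
pose c := x + x *m tensmx 1%:M P.
exists c.
  apply: mem_dual_row_code; rewrite trmx_tens mulmxDl -(mulmxA x) tensmx_mul mul1mx.
  (* The head entry -1 turns the correction into the negative of the column phi^T of the transposed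
     base generator. *)
  have -> : P *m (base_gen_mx phi G0bar)^T = block_mx 0 0 (- phi^T) 0.
    rewrite tr_block_mx mulmx_block !mul0mx !addr0 trmx0 mulmx0 tr_scalar_mx mul_mx_scalar.
    by rewrite scaleN1r.
  apply/rowP => q; case: (mxtens_indexP q) => i u.
  rewrite mxE [X in X + _]mxE [X in _ + X]mxE [RHS]mxE -big_split /=.
  (* For a row built from (-1, phi), the two contributions cancel term by term; for a row built from
     (0, G0bar), the correction vanishes and a check of [A] on [x] remains. *)
  case: (split_ordP u) => [v -> | v ->].
    rewrite big1 // => p _; case: (boolP (p \in I)) => [/x_head ->|].
      by rewrite !mul0r addr0.
    move=> /nhead[a [s ->]]; rewrite !tensmxE -mulrDr -mulrDr.
    rewrite [(_^T) (rshift _ _) _]mxE block_mxEur block_mxEdl.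
    by rewrite !mxE ord1 subrr !mulr0.
  have /rowP/(_ (mxtens_index (i, v))) := xA0.
  rewrite [in LHS]mxE [in RHS]mxE => xA0iv; rewrite -[RHS]xA0iv.
  apply: eq_bigr => p _; case: (boolP (p \in I)) => [/x_head ->|].
    by rewrite !mul0r addr0.
  move=> /nhead[a [s ->]]; rewrite trmx_tens !tensmxE block_mxEdr [fun_of_matrix 0 s v]mxE.
  rewrite !mulr0 addr0; congr (_ * (_ * _)).
  by rewrite [LHS]mxE [RHS]mxE block_mxEdr row_mxEr.
(* The correction is supported on the heads, so deleting them gives back [d]. *)
rewrite linearD /= x_del -[LHS]addr0; congr (_ + _); apply/rowP => j.
rewrite [LHS]mxE [RHS]mxE [RHS]mxE big1 // => p _.
have := enum_valP j; rewrite inE => /nhead[b [s ->]].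
case: (mxtens_indexP p) => a t; rewrite tensmxE.
case: (split_ordP t) => u ->; first by rewrite block_mxEur !mxE !mulr0.
by rewrite block_mxEdr !mxE !mulr0.
Qed.

End CodeLemmas.

Section LambdaBound.
Variables (B : finFieldType) (F : fieldExtType B) (n r : nat).
Variables (beta : 'rV[F]_n) (M : 'M[F]_(r, n)).

Definition twist (lam : 'rV[B]_n) : 'rV[F]_n := \row_j (lam 0 j *: beta 0 j).

Definition syndrome (lam : 'rV[B]_n) : 'M[B]_(r, \dim {:F}) :=
  \matrix_(i, k) coord (vbasis {:F}) k ((M *m (twist lam)^T) i 0).

Fact syndrome_is_linear : linear syndrome.
Proof.
move=> a u v; apply/matrixP => i k; rewrite !mxE -linearP; congr (coord _ _ _).
rewrite scaler_sumr -big_split; apply: eq_bigr => j _ /=.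
by rewrite !mxE scalerDl -scalerA mulrDr scalerAr.
Qed.

HB.instance Definition _ :=
  GRing.isLinear.Build B 'rV[B]_n 'M[B]_(r, \dim {:F}) *:%R syndrome
    syndrome_is_linear.

(** Rank-nullity over [B] for [syndrome]: expanding each check in a [B]-basis of [F] makes it
    [\dim {:F}] equations over [B], and their common kernel lies in [Lambda]. *)
Lemma dim_Lambda_parity (D : {vspace 'rV[F]_n}) :
  (parity_code M <= D)%VS -> (n <= \dim (Lambda beta D) + r * \dim {:F})%N.
Proof.
move=> /subvP MD.
have kerL : (lker (linfun syndrome) <= Lambda beta D)%VS.
  apply/subvP => lam; rewrite memv_ker lfunE /= => /eqP/matrixP syn0.
  rewrite mem_Lambda; apply/MD/parity_codeP/matrixP => i z; rewrite ord1.
  rewrite [RHS]mxE (coord_vbasis (memvf ((M *m (twist lam)^T) i 0))).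
  rewrite big1 // => k _; have := syn0 i k.
  by rewrite !mxE => ->; rewrite scale0r.
have -> : (n <= \dim (Lambda beta D) + r * \dim {:F})%N =
    (\dim {:'rV[B]_n} <= \dim (Lambda beta D) + r * \dim {:F})%N.
  by rewrite [in RHS]dimvf dim_matrix [(1 * n)%R]mul1n.
rewrite -(limg_ker_dim (linfun syndrome)) capfv; apply: leq_add (dimvS kerL) _.
by apply: leq_trans (dimvS (subvf _)) _; rewrite dimvf dim_matrix.
Qed.

End LambdaBound.

Theorem mainTheorem3
  (B : finFieldType) (F : fieldExtType B) (m : nat)
  (hm : \dim {:F} = m)
  (n0 k0 : nat) (C0 : {vspace 'rV[F]_(1 + n0)})
  (hC0 : \dim C0 = k0)
  (phi : 'rV[F]_n0) (G0bar : 'M[F]_(k0.-1, n0))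
  (hphi : phi != 0)
  (hG0 : is_generator_mx (base_gen_mx phi G0bar) C0)
  (K N : nat) (hK : (1 <= K)%N) (hKN : (K < N)%N)
  (Hcomp : 'M[F]_(N - K, N)) (hHcomp : is_comp_parity_mx Hcomp)
  (Gcomp : 'M[F]_(K, N))
  (hGcomp : is_generator_mx Gcomp (parity_code Hcomp))
  (hsys : is_systematic Gcomp)
  (beta : 'rV[F]_#|~: block_heads N n0|)
  (hbeta : forall j, beta 0 j != 0) :
  let D := dual_code (tensor_code Gcomp (base_gen_mx phi G0bar)) in
  let Dbar := puncture (block_heads N n0) D in
  let L := Lambda beta Dbar in
  ((N * n0)%:Z - (m * K)%:Z * (k0%:Z - 1) <= (\dim L)%:Z) /\
  (k0%:R <= (N * n0)%:R / (K * m)%:R :> rat -> (K * m <= \dim L)%N).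
Proof.
move=> D Dbar L.
(* The basis has 1 + [k0.-1] rows, which excludes [k0] = 0, where the truncated predecessor would
   not be k0 - 1. *)
have k0E : (k0.-1.+1 = k0)%N.
  rewrite -{2}hC0 (size_basis (X := in_tuple _) hG0) size_map -cardE card_ord.
  by rewrite add1n.
have m_gt0 : (0 < m)%N by rewrite -hm adim_gt0.
have := dim_Lambda_parity _ _ _ _ beta _ _
  (parity_sub_puncture_dual _ _ _ _ _ Gcomp phi G0bar).
rewrite -/D -/Dbar -/L hm; move: (\dim L) => dL.
rewrite card_block_headsC => dimL.
have km_gt0 : (0 < K * m)%N by rewrite muln_gt0 hK.
split; first by nia.
(* Clearing the denominator gives k0 K m <= N n0, so the first bound leaves at least K m. *)
rewrite ler_pdivlMr ?ltr0n // -natrM ler_nat; nia.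
Qed.
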